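(* Let $G_1$ be an $r_1$-regular graph with $r_1\ge1$ on $n_1$ vertices and $m_1$ edges, and let $G_2$ be an $r_2$-regular graph with $r_2\ge1$ on $n_2$ vertices. Let $0=\mu_1,\mu_2,\ldots,\mu_{n_1}$ and $0=\nu_1,\nu_2,\ldots,\nu_{n_2}$ be the normalized Laplacian eigenvalues of $G_1$ and $G_2$, respectively. Then the numbers of spanning trees satisfy $$t(G_1\dot{\vee}G_2)=2^{m_1-n_1+1}\prod_{i=2}^{n_1}(2n_2+r_1\mu_i)\prod_{j=2}^{n_2}(n_1+r_2\nu_j)$$ and $$t(G_1\veebar G_2)=r_1^{\,n_1}(2+n_2)^{m_1-n_1}\prod_{i=2}^{n_1}(n_2+\mu_i)\prod_{j=2}^{n_2}(m_1+r_2\nu_j).$$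
   Context: All graphs are finite and simple; $t(G)$ denotes the number of spanning trees of $G$. For a graph $G$ without isolated vertices, with adjacency matrix $A(G)$ and diagonal degree matrix $D(G)$, the normalized Laplacian matrix is $\mathcal{L}(G)=I-D(G)^{-1/2}A(G)D(G)^{-1/2}$, and its eigenvalues are its normalized Laplacian eigenvalues. The subdivision graph $S(G)$ of $G$ is obtained by inserting a new vertex into every edge of $G$; the set of these new vertices is denoted $I(G)$. The subdivision-vertex join $G_1\dot{\vee}G_2$ is the graph obtained from $S(G_1)$ and a disjoint copy of $G_2$ by joining each vertex of $V(G_1)$ with every vertex of $V(G_2)$. The subdivision-edge join $G_1\veebar G_2$ is the graph obtained from $S(G_1)$ and a disjoint copy of $G_2$ by joining each vertex of $I(G_1)$ with every vertex of $V(G_2)$. *)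

(* Defs.v *)
From HB Require Import structures.
From mathcomp Require Import all_boot all_order all_algebra.
Set Implicit Arguments. Unset Strict Implicit. Unset Printing Implicit Defensive.
Import Order.TTheory GRing.Theory Num.Theory.

Definition simple_graph (V : finType) (e : rel V) : Prop :=
  symmetric e /\ irreflexive e.

Definition deg (V : finType) (e : rel V) (v : V) : nat := #|[set w | e v w]|.

Definition regular (V : finType) (e : rel V) (r : nat) : Prop :=
  forall v, deg e v = r.

Definition is_edge (V : finType) (e : rel V) (A : {set V}) : bool :=
  [exists x, exists y, e x y && (A == [set x; y])].

Definition edge_set (V : finType) (e : rel V) : {set {set V}} :=
  [set A | is_edge e A].

(* The type of edges of the graph (used as the new subdivision vertices). *)
Definition edge_t (V : finType) (e : rel V) := {A : {set V} | is_edge e A}.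

Definition trel (V : finType) (T : {set {set V}}) : rel V :=
  fun x y => [set x; y] \in T.

(* T is a spanning tree of (V,e): a set of edges of the graph such that
   the spanning subgraph (V,T) is connected and acyclic (no edge of T lies on
   a cycle, i.e. removing any edge {x,y} of T disconnects x from y). *)
Definition spanning_tree (V : finType) (e : rel V) (T : {set {set V}}) : bool :=
  [&& T \subset edge_set e,
      [forall x, forall y, connect (trel T) x y] &
      [forall A in T, forall x, forall y,
         (A == [set x; y]) ==> ~~ connect (trel (T :\ A)) x y]].

Definition num_spanning_trees (V : finType) (e : rel V) : nat :=
  #|[set T : {set {set V}} | spanning_tree e T]|.

Local Open Scope ring_scope.
Definition adj_mx (R : rcfType) (n : nat) (e : rel 'I_n) : 'M[R]_n :=
  \matrix_(i, j) (e i j)%:R.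

Definition nlap (R : rcfType) (n : nat) (e : rel 'I_n) : 'M[R]_n :=
  \matrix_(i, j) ((i == j)%:R
     - (e i j)%:R / (Num.sqrt (deg e i)%:R * Num.sqrt (deg e j)%:R)).

Local Close Scope ring_scope.
(* Vertex set of S(G1) together with G2: V(G1) + I(G1) + V(G2). *)
Definition join_vert (n1 n2 : nat) (e1 : rel 'I_n1) : finType :=
  (('I_n1 + edge_t e1) + 'I_n2)%type.

Definition svjoin (n1 n2 : nat) (e1 : rel 'I_n1) (e2 : rel 'I_n2)
  : rel (join_vert n2 e1) :=
  fun a b =>
    match a, b with
    | inl (inl x), inl (inr A) => x \in val A
    | inl (inr A), inl (inl x) => x \in val A
    | inr y, inr y' => e2 y y'
    | inl (inl _), inr _ => true
    | inr _, inl (inl _) => true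
    | _, _ => false
    end.

Definition sejoin (n1 n2 : nat) (e1 : rel 'I_n1) (e2 : rel 'I_n2)
  : rel (join_vert n2 e1) :=
  fun a b =>
    match a, b with
    | inl (inl x), inl (inr A) => x \in val A
    | inl (inr A), inl (inl x) => x \in val A
    | inr y, inr y' => e2 y y'
    | inl (inr _), inr _ => true
    | inr _, inl (inr _) => true
    | _, _ => false
    end.

Arguments svjoin {n1 n2} e1 e2 _ _.
Arguments sejoin {n1 n2} e1 e2 _ _.
Arguments nlap R {n} e.

(* Main.v *)
Require Import Defs.
From HB Require Import structures.
From mathcomp Require Import all_boot all_order all_algebra.
From mathcomp Require Import perm ring.
Import Order.TTheory GRing.Theory Num.Theory.
Set Implicit Arguments. Unset Strict Implicit. Unset Printing Implicit Defensive.

(** Both joins come down to one evaluation of a determinant built from the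
    Laplacian [L].

    Matrix-tree theorem: for a nonempty set [S] of roots, the number of spanning
    forests with one root in each component and the determinant of [L] with the
    rows and columns of [S] deleted satisfy the same recursion.  If [xy] is an
    edge with [x] in [S] and [y] outside, both are the sum of their values for
    [(E - xy, S)] and [(E - xy, S + y)]; if no edge leaves [S], both are [0],
    or [1] when [S] is everything.

    Since [L] has zero row and column sums, [det (L + u v^T)] is the number of
    spanning trees times the sums of the entries of [u] and of [v].  For a join,
    let [u] be the indicator of the vertices of [S(G1)] that are joined to [G2],
    and [v] that of [V(G2)]: then [u v^T] cancels one off-diagonal block of [L].
    The two diagonal blocks are evaluated with [B B^T = r1 I + A(G1)], where [B]
    is the incidence matrix, and [A = r (I - nlap)]. *)

(** * Rooted spanning forests *)

Lemma eq_set2 (V : finType) (a b c d : V) :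
  ([set a; b] == [set c; d]) = (a == c) && (b == d) || (a == d) && (b == c).
Proof.
apply/eqP/idP => [abcd|/orP[]/andP[/eqP-> /eqP->] //]; last by rewrite setUC.
have : a \in [set c; d] by rewrite -abcd set21.
have : b \in [set c; d] by rewrite -abcd set22.
have : c \in [set a; b] by rewrite abcd set21.
have : d \in [set a; b] by rewrite abcd set22.
rewrite !inE !(eq_sym c) !(eq_sym d).
by case: (a == c); case: (a == d); case: (b == c); case: (b == d).
Qed.

Lemma card_set_setU1 (I : finType) (a : I) (P : pred {set I}) :
  #|[set A | P A & a \in A]| = #|[set A | P (a |: A) & a \notin A]|.
Proof.
rewrite -!sum1dep_card (reindex_onto (setU [set a]) (fun A => A :\ a)) /=.
  apply: eq_bigl => A; rewrite setU11 andbT; congr (_ && _).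
  by apply/eqP/idP => [<-|/setU1K //]; rewrite !inE eqxx.
by move=> A /andP[_ aA]; rewrite setD1K.
Qed.

Section RootedForests.

Variable V : finType.
Implicit Types (T E : {set {set V}}) (S : {set V}).

(* All roots are pairwise adjacent, so that [T] is a forest with one root in each
   component exactly when [T] is a spanning tree for this adjacency. *)
Definition rooted_rel T S : rel V :=
  fun x y => trel T x y || (x \in S) && (y \in S).

Definition rooted_forest E S T : bool :=
  [&& T \subset E,
      [forall x, forall y, connect (rooted_rel T S) x y] &
      [forall A in T, forall x, forall y,
         (A == [set x; y]) ==> ~~ connect (rooted_rel (T :\ A) S) x y]].

Definition num_rooted_forests E S : nat := #|[set T | rooted_forest E S T]|.

Lemma rooted_forestP E S T :
  reflect [/\ T \subset E,
              forall x y, connect (rooted_rel T S) x y &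
              forall x y, [set x; y] \in T ->
                ~~ connect (rooted_rel (T :\ [set x; y]) S) x y]
          (rooted_forest E S T).
Proof.
apply: (iffP and3P) => -[TE conn acyc]; split=> //.
- by move=> x y; move/forallP/(_ x)/forallP: conn; apply.
- move=> x y xyT; have /forall_inP/(_ _ xyT)/forallP/(_ x)/forallP/(_ y) := acyc.
  by rewrite eqxx.
- by apply/forallP => x; apply/forallP => y.
apply/forall_inP => A AT; apply/forallP => x; apply/forallP => y.
by apply/implyP => /eqP AE; move: AT; rewrite AE; apply: acyc.
Qed.

Lemma trel_sym T : symmetric (trel T).
Proof. by move=> x y; rewrite /trel setUC. Qed.

Lemma rooted_connect_sym T S : connect_sym (rooted_rel T S).
Proof. by apply: sym_connect_sym => x y; rewrite /rooted_rel trel_sym andbC. Qed.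

Lemma connect_rooted1 T r : connect (rooted_rel T [set r]) =2 connect (trel T).
Proof.
move=> x y; apply/idP/idP; apply: connect_sub => u v uv.
  by case/orP: uv => [/connect1 //|/andP[/set1P-> /set1P->]].
by apply: connect1; rewrite /rooted_rel uv.
Qed.

Lemma num_spanning_trees_rooted (e : rel V) r :
  num_spanning_trees e = num_rooted_forests (edge_set e) [set r].
Proof.
apply: eq_card => T; rewrite !inE /spanning_tree /rooted_forest.
congr [&& _, _ & _].
  by apply: eq_forallb => x; apply: eq_forallb => y; rewrite connect_rooted1.
apply: eq_forallb => A; congr (_ ==> _).
by apply: eq_forallb => x; apply: eq_forallb => y; rewrite connect_rooted1.
Qed.

Lemma connect_rootedU1 T S x y : x \in S ->
  connect (rooted_rel ([set x; y] |: T) S) =2 connect (rooted_rel T (y |: S)).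
Proof.
move=> xS u v; apply/idP/idP; apply: connect_sub => {u v} u v.
  rewrite /rooted_rel /trel !inE eq_set2 => uv; apply: connect1; rewrite !inE.
  case/orP: uv => [/orP[/orP[]/andP[/eqP-> /eqP->]|->//]|/andP[-> ->]];
    by rewrite ?eqxx ?xS !orbT.
have connect_x z : z \in y |: S -> connect (rooted_rel ([set x; y] |: T) S) z x.
  case/setU1P => [->|zS]; apply: connect1; last by rewrite /rooted_rel zS xS orbT.
  by rewrite /rooted_rel /trel setUC setU11.
case/orP => [uvT|/andP[/connect_x ux /connect_x vx]].
  by apply: connect1; rewrite /rooted_rel /trel in_setU1 [_ \in T]uvT orbT.
by apply: connect_trans ux _; rewrite rooted_connect_sym.
Qed.

Lemma path_rooted_rel_delete T S y z w p : y \notin z :: p ->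
  path (rooted_rel T S) z p -> path (rooted_rel (T :\ [set y; w]) S) z p.
Proof.
move=> yzp; apply: (sub_in_path (P := [in z :: p])); last exact: allss.
move=> u v uzp vzp; rewrite /rooted_rel => /orP[uvT|->]; last by rewrite orbT.
rewrite /trel in_setD1 [_ \in T]uvT andbT eq_set2 negb_or !negb_and.
by rewrite (memPn yzp _ uzp) (memPn yzp _ vzp) orbT.
Qed.

(* On a simple path from [y] to [x], the first edge [yz] belongs to [T], and the
   rest of the path together with the roots [x] and [y] still connects [z] to
   [y]. *)
Lemma rooted_forest_separated E S T x y : x \in S -> y \notin S ->
  rooted_forest E (y |: S) T -> ~~ connect (rooted_rel T S) y x.
Proof.
move=> xS yS /rooted_forestP[_ _ acyc]; apply/connectP => -[p0 p0_path p0_last].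
have [p [p_path p_uniq p_last]] :
    exists p, [/\ path (rooted_rel T S) y p, uniq (y :: p) & x = last y p].
  by case/shortenP: p0_path p0_last => p *; exists p.
case: p p_path p_uniq p_last => [_ _ /= xy|z p /= /andP[yz zp_path]].
  by rewrite -xy xS in yS.
case/andP=> y_notin _ p_last.
have yzT : [set y; z] \in T by case/orP: yz => //; rewrite (negbTE yS).
have /negP[] := acyc _ _ yzT; rewrite rooted_connect_sym.
apply: (@connect_trans _ _ x); last first.
  by apply: connect1; rewrite /rooted_rel !inE xS eqxx !orbT.
apply: connect_sub (_ : connect (rooted_rel (T :\ [set y; z]) S) z x).
  move=> u v uv; apply: connect1; rewrite /rooted_rel !inE.
  by case/orP: uv => [->|/andP[-> ->]] //; rewrite !orbT.
by apply/connectP; exists p => //; apply: path_rooted_rel_delete.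
Qed.

Lemma rooted_forest_setU1 E S T x y :
    x \in S -> y \notin S -> [set x; y] \in E -> [set x; y] \notin T ->
  rooted_forest E S ([set x; y] |: T) =
    rooted_forest (E :\ [set x; y]) (y |: S) T.
Proof.
move=> xS yS; set A := [set x; y] => AE AT.
have deleteC B : B \in T -> (A |: T) :\ B = A |: (T :\ B).
  move=> BT; rewrite setDUl; congr (_ :|: _); apply/setDidPl.
  by rewrite disjoints1 inE; apply: contraNneq AT => ->.
have subE : (A |: T \subset E) = (T \subset E :\ A).
  by rewrite subUset sub1set AE subsetD1 AT andbT.
apply/rooted_forestP/rooted_forestP => -[]; rewrite subE => TE conn acyc.
  split=> // u v => [|uvT]; first by rewrite -(connect_rootedU1 T y xS).
  rewrite -(connect_rootedU1 _ y xS) -/A -deleteC //; apply: acyc.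
  by rewrite in_setU1 uvT orbT.
split=> // u v => [|/setU1P[uvA|uvT]]; first by rewrite connect_rootedU1.
  have yx_separated : ~~ connect (rooted_rel T S) y x.
    by apply: (rooted_forest_separated xS yS (E := E :\ A)); apply/rooted_forestP.
  rewrite uvA setU1K //; move/eqP: uvA; rewrite eq_set2.
  by case/orP => /andP[/eqP-> /eqP->]; rewrite // rooted_connect_sym.
by rewrite deleteC // connect_rootedU1 //; apply: acyc.
Qed.

Lemma num_rooted_forests_rec E S x y :
    x \in S -> y \notin S -> [set x; y] \in E ->
  num_rooted_forests E S =
    num_rooted_forests (E :\ [set x; y]) S +
    num_rooted_forests (E :\ [set x; y]) (y |: S).
Proof.
move=> xS yS; set A := [set x; y] => AE.
rewrite {1}/num_rooted_forests -(cardsID [set T : {set {set V}} | A \in T]) addnC.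
congr addn.
  by apply: eq_card => T; rewrite !inE /rooted_forest subsetD1 -andbA andbCA.
rewrite -setIdE card_set_setU1; apply: eq_card => T; rewrite !inE.
have [AT|AT] := boolP (A \in T); last by rewrite andbT rooted_forest_setU1.
by rewrite /rooted_forest subsetD1 AT !andbF.
Qed.

Lemma num_rooted_forests_setT (e : rel V) E : E \subset edge_set e ->
  num_rooted_forests E setT = 1.
Proof.
move=> Ee; rewrite /num_rooted_forests -(cards1 (set0 : {set {set V}})).
have connectT T x y : connect (rooted_rel T setT) x y.
  by apply: connect1; rewrite /rooted_rel !inE orbT.
apply: eq_card => T; rewrite !inE; apply/rooted_forestP/eqP => [[TE _ acyc]|->].
  apply/setP => A; rewrite inE; apply/negP => AT.
  have := subsetP Ee _ (subsetP TE _ AT); rewrite inE.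
  case/existsP=> x /existsP[y /andP[_ /eqP AE]]; rewrite AE in AT.
  by have := acyc _ _ AT; rewrite connectT.
by split=> // [|x y]; rewrite ?sub0set // inE.
Qed.

Definition no_edge_leaves E S :=
  forall x y, x \in S -> y \notin S -> [set x; y] \notin E.

Lemma num_rooted_forests_closed E S x y :
  no_edge_leaves E S -> x \in S -> y \notin S -> num_rooted_forests E S = 0.
Proof.
move=> closedS xS yS; apply/eqP; rewrite cards_eq0 -subset0; apply/subsetP => T.
rewrite !inE => /rooted_forestP[TE conn _].
have S_closed : closed (rooted_rel T S) S.
  apply: (intro_closed (rooted_connect_sym T S)) => u v.
  case/orP => [uvT uS|/andP[] //]; apply: contraTT uvT => vS.
  exact: contra (subsetP TE _) (closedS _ _ uS vS).
by rewrite -(closed_connect S_closed (conn x y)) xS in yS.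
Qed.

End RootedForests.

Local Open Scope ring_scope.

(** * Determinants *)

Section Determinants.

Variable R : comPzRingType.

Lemma cofactor_diag n (A : 'M[R]_n) k : cofactor A k k = \det (row' k (col' k A)).
Proof. by rewrite /cofactor addnn -signr_odd odd_double mul1r. Qed.

Lemma det_delta_row n (A : 'M[R]_n) k :
  (forall j, A k j = (k == j)%:R) -> \det A = \det (row' k (col' k A)).
Proof.
move=> Ak; rewrite (expand_det_row _ k) (bigD1 k) //= big1 => [|j jk].
  by rewrite Ak eqxx mul1r addr0 cofactor_diag.
by rewrite Ak eq_sym (negbTE jk) mul0r.
Qed.

Lemma det_add_delta n (A : 'M[R]_n) k :
  \det (A + delta_mx k k) = \det A + \det (row' k (col' k A)).
Proof.
have cofactorE j : cofactor (A + delta_mx k k) k j = cofactor A k j.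
  rewrite /cofactor; congr (_ * \det _); apply/matrixP => a b.
  by rewrite !mxE [lift k a == k]eq_sym (negbTE (neq_lift k a)) addr0.
rewrite !(expand_det_row _ k) -cofactor_diag.
under eq_bigr => j _ do rewrite cofactorE !mxE eqxx mulrDl.
rewrite big_split; congr (_ + _); rewrite (bigD1 k) //= eqxx mul1r big1 ?addr0 //.
by move=> j /negbTE->; rewrite mul0r.
Qed.

Lemma det_ones_border n (u : 'cV[R]_(1 + n)) :
  \det (block_mx (usubmx u) (- const_mx 1) (dsubmx u) 1%:M) = \sum_i u i 0.
Proof.
pose U : 'M[R]_(1 + n) := block_mx 1%:M (const_mx 1) 0 1%:M.
have detU : \det U = 1 by rewrite det_ublock !det1 mulr1.
rewrite -[LHS]mul1r -{1}detU -det_mulmx mulmx_block.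
rewrite !mul1mx !mul0mx mulmx1 !add0r addNr det_lblock det1 mulr1 det_mx11.
rewrite big_split_ord big_ord1 !mxE; congr (_ + _).
by apply: eq_bigr => i _; rewrite !mxE mul1r.
Qed.

(* The hypotheses determine [L] from its lower right block [M]: it is [K^T M K]
   with [K := (-1 | I)].  Bordering [K] on top by [v] and [K^T] on the left by [u]
   makes all factors of [L + u v] square. *)
Lemma det_add_rank1 n (L : 'M[R]_(1 + n)) (u : 'cV_(1 + n)) (v : 'rV_(1 + n)) :
    L *m const_mx 1 = 0 :> 'cV_(1 + n) -> const_mx 1 *m L = 0 :> 'rV_(1 + n) ->
  \det (L + u *m v) = (\sum_i u i 0) * (\sum_j v 0 j) * \det (drsubmx L).
Proof.
rewrite -[L]submxK.
move: (ulsubmx L) (ursubmx L) (dlsubmx L) (drsubmx L) => a b c M.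
rewrite block_mxKdr -col_mx_const -row_mx_const mul_block_col mul_row_block.
have const1 : const_mx 1 = 1 :> 'M[R]_1 by apply/matrixP => i j; rewrite !mxE !ord1.
rewrite -[0]col_mx0 -[X in _ -> _ = X -> _]row_mx0 const1 !mulmx1 !mul1mx.
case/eq_col_mx=> /eqP; rewrite addr_eq0 => /eqP aE.
move=> /eqP; rewrite addr_eq0 => /eqP cE.
case/eq_row_mx=> _ /eqP; rewrite addr_eq0 => /eqP bE.
have -> : block_mx a b c M + u *m v =
    block_mx (usubmx u) (- const_mx 1) (dsubmx u) 1%:M *m block_mx 1 0 0 M
      *m block_mx (lsubmx v) (rsubmx v) (- const_mx 1) 1%:M.
  rewrite -[u in LHS]vsubmxK -[v in LHS]hsubmxK mul_col_row add_block_mx.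
  rewrite !mulmx_block.
  rewrite !mulmx0 !mulmx1 !mul1mx !addr0 !add0r aE bE cE.
  by rewrite !mulNmx !mulmxN !opprK; congr block_mx; rewrite addrC.
rewrite !det_mulmx det_ones_border det_ublock det1 mul1r mulrAC; congr (_ * _ * _).
transitivity (\sum_i v^T i 0); last by apply: eq_bigr => i _; rewrite mxE.
rewrite -det_ones_border -det_tr tr_block_mx raddfN /=.
by rewrite trmx_const trmx1 trmx_lsub trmx_rsub.
Qed.

Lemma det_scalar_block n m (A : 'M[R]_n) (B : 'M_(n, m)) (C : 'M_(m, n)) b :
  b ^+ n * \det (block_mx A B C b%:M) = b ^+ m * \det (b *: A - B *m C).
Proof.
have detl : \det (block_mx b%:M 0 (- C) 1%:M : 'M[R]_(n + m)) = b ^+ n.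
  by rewrite det_lblock det1 mulr1 det_scalar.
rewrite -detl mulrC -det_mulmx mulmx_block !mulmx0 !mulmx1 !add0r mulmxN.
by rewrite !mul_mx_scalar mul_scalar_mx scalerN subrr det_ublock det_scalar mulrC.
Qed.

End Determinants.

Section FiniteIndex.

Variable R : comPzRingType.
Implicit Types V A B C : finType.

Definition fin_mx A B (F : A -> B -> R) : 'M[R]_(#|A|, #|B|) :=
  \matrix_(i, j) F (enum_val i) (enum_val j).

Lemma det_fin_mx V n (f : 'I_n -> V) (F : V -> V -> R) :
  bijective f -> \det (fin_mx F) = \det (\matrix_(i, j) F (f i) (f j)).
Proof.
move=> f_bij; have n_card : n = #|V| by rewrite -(bij_eq_card f_bij) card_ord.
subst n; have s_inj : injective (enum_rank \o f).
  exact: inj_comp enum_rank_inj (bij_inj f_bij).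
pose s := perm s_inj.
have -> : \matrix_(i, j) F (f i) (f j) = row_perm s (col_perm s (fin_mx F)).
  by apply/matrixP => i j; rewrite !mxE !permE /= !enum_rankK.
rewrite row_permE col_permE !det_mulmx !det_perm odd_permV mulrCA -signr_addb.
by rewrite addbb mulr1.
Qed.

Lemma det_fin_mx_sum A B (F : A + B -> A + B -> R) :
  \det (fin_mx F) =
    \det (block_mx (fin_mx (fun x y => F (inl x) (inl y)))
                   (fin_mx (fun x y => F (inl x) (inr y)))
                   (fin_mx (fun x y => F (inr x) (inl y)))
                   (fin_mx (fun x y => F (inr x) (inr y)))).
Proof.
pose f (i : 'I_(#|A| + #|B|)) : A + B :=
  match split i with inl a => inl (enum_val a) | inr b => inr (enum_val b) end.
pose g (x : A + B) : 'I_(#|A| + #|B|) :=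
  match x with
  | inl a => lshift _ (enum_rank a)
  | inr b => rshift _ (enum_rank b)
  end.
have f_bij : bijective f.
  exists g => [i|[a|b]]; rewrite /f /g.
  - by rewrite -[RHS]splitK; case: (split i) => [a|b]; rewrite enum_valK.
  - by rewrite (unsplitK (inl _)) enum_rankK.
  - by rewrite (unsplitK (inr _)) enum_rankK.
rewrite (det_fin_mx F f_bij); congr (\det _); apply/matrixP => i j.
rewrite -[i]splitK -[j]splitK mxE /f !unsplitK.
by case: (split i) (split j) => [a|b] [a'|b'] /=;
  rewrite ?block_mxEul ?block_mxEur ?block_mxEdl ?block_mxEdr mxE.
Qed.

Lemma fin_mx_scalar V (c : R) : fin_mx (fun x y : V => c *+ (x == y)) = c%:M.
Proof. by apply/matrixP => i j; rewrite !mxE (inj_eq enum_val_inj). Qed.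

Lemma fin_mx_mul A B C (F : A -> B -> R) (G : B -> C -> R) :
  fin_mx F *m fin_mx G = fin_mx (fun x z => \sum_y F x y * G y z).
Proof.
apply/matrixP => i j; rewrite !mxE [RHS]big_enum_val.
by apply: eq_bigr => k _; rewrite !mxE.
Qed.

Lemma det_fin_mx_kernel V (F : V -> V -> R) (g : V -> R) y :
  (forall x, \sum_z F x z * g z = 0) -> \det (fin_mx F) * g y = 0.
Proof.
move=> Fg; pose v : 'cV_#|V| := \col_i g (enum_val i).
have Fv : fin_mx F *m v = 0.
  apply/matrixP => i j; rewrite !mxE -[RHS](Fg (enum_val i)) [RHS]big_enum_val.
  by apply: eq_bigr => k _; rewrite !mxE.
have := mul_adj_mx (fin_mx F) => /(congr1 (mulmx^~ v)).
rewrite -mulmxA Fv mulmx0 mul_scalar_mx => /matrixP/(_ (enum_rank y) 0).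
by rewrite !mxE enum_rankK.
Qed.

End FiniteIndex.

(** * The matrix-tree theorem *)

Lemma card_set_sum (I : finType) (P : pred I) : #|[set i | P i]| = (\sum_i P i)%N.
Proof. by rewrite -sum1dep_card big_mkcond; apply: eq_bigr => i _; case: (P i). Qed.

Lemma is_edge_set2 (V : finType) (e : rel V) x y :
  symmetric e -> is_edge e [set x; y] = e x y.
Proof.
move=> e_sym; apply/existsP/idP => [[u /existsP[v]]|exy].
  case/andP => euv; rewrite eq_set2.
  by case/orP=> /andP[/eqP-> /eqP->] //; rewrite e_sym.
by exists x; apply/existsP; exists y; rewrite exy eqxx.
Qed.

Section MatrixTree.

Variables (R : comPzRingType) (V : finType).
Implicit Types (e : rel V) (E : {set {set V}}) (S : {set V}).

Definition laplacian e (x y : V) : R := (deg e x)%:R *+ (x == y) - (e x y)%:R.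

(* The rows and columns of the roots are replaced by those of the identity, instead
   of being deleted, so that the size of the matrix does not depend on [S]. *)
Definition rooted_laplacian E S (x y : V) : R :=
  if (x \in S) || (y \in S) then (x == y)%:R else laplacian (trel E) x y.

Lemma laplacian_sym e x y : symmetric e -> laplacian e x y = laplacian e y x.
Proof.
move=> e_sym; rewrite /laplacian e_sym eq_sym.
by case: (eqVneq y x) => [->|]; rewrite // !mulr0n.
Qed.

Lemma eq_laplacian e e' : e =2 e' -> laplacian e =2 laplacian e'.
Proof.
move=> ee' x y; rewrite /laplacian ee' /deg !card_set_sum.
by under eq_bigr => z _ do rewrite ee'.
Qed.

Lemma sum_laplacian e x : \sum_y laplacian e x y = 0.
Proof.
rewrite sumrB (bigD1 x) //= eqxx mulr1n big1 => [|y yx].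
  by rewrite addr0 /deg card_set_sum natr_sum subrr.
by rewrite eq_sym (negbTE yx) mulr0n.
Qed.

Lemma laplacian_delete_edge E x y u v :
    [set x; y] \in E -> u != x -> v != x ->
  laplacian (trel E) u v =
    laplacian (trel (E :\ [set x; y])) u v + ((u == y) && (v == y))%:R.
Proof.
move=> xyE ux vx; set E' := E :\ [set x; y].
have trelE w : trel E u w = (trel E' u w + ((u == y) && (w == x)))%N :> nat.
  rewrite /trel in_setD1 eq_set2 (negbTE ux) /=.
  by case: (@andP (u == y)) => [[/eqP-> /eqP->]|_]; rewrite ?addn0 //= setUC xyE.
have degE : deg (trel E) u = (deg (trel E') u + (u == y))%N.
  rewrite /deg !card_set_sum (eq_bigr _ (fun w _ => trelE w)) big_split /=.
  congr (_ + _)%N.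
  rewrite (bigD1 x) //= eqxx andbT big1 ?addn0 // => w /negbTE->.
  by rewrite andbF.
rewrite /laplacian trelE (negbTE vx) andbF addn0 degE natrD mulrnDl addrAC.
by have [->|] := eqVneq u y; rewrite ?mul0rn // [v == y]eq_sym.
Qed.

Lemma det_rooted_laplacianU1 E S y :
  \det (fin_mx (rooted_laplacian E (y |: S))) =
    \det (row' (enum_rank y) (col' (enum_rank y) (fin_mx (rooted_laplacian E S)))).
Proof.
rewrite (@det_delta_row _ _ _ (enum_rank y)) => [|j]; last first.
  rewrite mxE enum_rankK /rooted_laplacian setU11.
  by rewrite -(inj_eq enum_val_inj) enum_rankK.
have lift_neq i : (enum_val (lift (enum_rank y) i) == y) = false.
  by rewrite -(inj_eq enum_rank_inj) enum_valK eq_sym; apply/negbTE/neq_lift.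
congr (\det _); apply/matrixP => i j.
by rewrite !mxE /rooted_laplacian !in_setU1 !lift_neq.
Qed.

Lemma det_rooted_laplacian_rec E S x y :
    x \in S -> y \notin S -> [set x; y] \in E ->
  \det (fin_mx (rooted_laplacian E S)) =
    \det (fin_mx (rooted_laplacian (E :\ [set x; y]) S)) +
    \det (fin_mx (rooted_laplacian (E :\ [set x; y]) (y |: S))).
Proof.
move=> xS yS xyE; rewrite det_rooted_laplacianU1 -det_add_delta; congr (\det _).
apply/matrixP => i j; rewrite !mxE -!(inj_eq enum_val_inj) enum_rankK.
move: (enum_val i) (enum_val j) => u v; rewrite /rooted_laplacian.
have notin_neq w z : w \in S -> z \notin S -> (z == w) = false.
  by move=> wS zS; apply: contraNF zS => /eqP->.
have [uS|uS] := boolP (u \in S).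
  by rewrite [u == y]eq_sym (notin_neq u y) // addr0.
have [vS|vS] := boolP (v \in S).
  by rewrite [v == y]eq_sym (notin_neq v y) // andbF addr0.
by rewrite /= (laplacian_delete_edge xyE) ?(notin_neq x).
Qed.

Lemma det_rooted_laplacian_closed E S y : y \notin S ->
  no_edge_leaves E S -> \det (fin_mx (rooted_laplacian E S)) = 0.
Proof.
move=> yS closedS; pose outside x : R := (x \notin S)%:R.
suff kernel x : \sum_z rooted_laplacian E S x z * outside z = 0.
  by have := det_fin_mx_kernel y kernel; rewrite /outside yS mulr1.
rewrite /outside /rooted_laplacian; have [xS|xS] := boolP (x \in S).
  rewrite big1 // => z _ /=.
  by have [<-|] := eqVneq x z; rewrite ?xS (mulr0, mul0r).
rewrite -[RHS](sum_laplacian (trel E) x); apply: eq_bigr => z _ /=.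
have [zS|zS] := boolP (z \in S); last by rewrite mulr1.
have /negbTE xz : x != z by apply: contraNneq xS => ->.
by rewrite mulr0 /laplacian xz trel_sym /trel (negbTE (closedS _ _ zS xS)) subr0.
Qed.

Theorem rooted_matrix_tree e E S : E \subset edge_set e -> S != set0 ->
  \det (fin_mx (rooted_laplacian E S)) = (num_rooted_forests E S)%:R.
Proof.
have [m] := ubnP #|E|; elim: m E S => // m IH E S ltEm Ee /set0Pn[x0 x0S].
have [/exists_inP[x xS /exists_inP[y yS xyE]]|no_edge] := boolP
    [exists x in S, exists y in ~: S, [set x; y] \in E].
  rewrite inE in yS; have E'e := subset_trans (subsetDl E [set [set x; y]]) Ee.
  rewrite (det_rooted_laplacian_rec xS yS xyE) (num_rooted_forests_rec xS yS xyE).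
  have E'm : (#|E :\ [set x; y]| < m)%N.
    by move: ltEm; rewrite (cardsD1 [set x; y] E) xyE.
  by rewrite natrD !IH //; apply/set0Pn; exists x; rewrite // in_setU1 xS orbT.
have closedS : no_edge_leaves E S.
  move=> x y xS yS; apply: contra no_edge => xyE.
  by apply/exists_inP; exists x => //; apply/exists_inP; exists y; rewrite ?inE.
have [->|] := eqVneq S setT.
  rewrite (num_rooted_forests_setT Ee) -(det1 _ #|V|) -fin_mx_scalar.
  by congr (\det _); apply/matrixP => i j; rewrite !mxE /rooted_laplacian inE.
rewrite -subTset => /subsetPn[y _ yS].
rewrite (det_rooted_laplacian_closed yS closedS).
by rewrite (num_rooted_forests_closed closedS x0S yS).
Qed.

Theorem matrix_tree e n (f : 'I_(1 + n) -> V) : symmetric e -> bijective f ->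
  \det (drsubmx (\matrix_(i, j) laplacian e (f i) (f j) : 'M_(1 + n))) =
    (num_spanning_trees e)%:R.
Proof.
move=> e_sym f_bij; set L := \matrix_(i, j) _; have f_inj := bij_inj f_bij.
have trelE : trel (edge_set e) =2 e by move=> x y; rewrite /trel inE is_edge_set2.
rewrite (num_spanning_trees_rooted e (f 0)) -(@rooted_matrix_tree e) //; last first.
  by apply/set0Pn; exists (f 0); rewrite set11.
rewrite (det_fin_mx _ f_bij).
transitivity (\det (block_mx (1 : 'M_1) 0 0 (drsubmx L))).
  by rewrite det_ublock det1 mul1r.
congr (\det _); apply/matrixP => i j; rewrite -[i]splitK -[j]splitK.
rewrite [in RHS]mxE /rooted_laplacian !inE !(inj_eq f_inj).
case: (split i) (split j) => [a|a] [b|b] /=;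
  rewrite ?block_mxEul ?block_mxEur ?block_mxEdl ?block_mxEdr !mxE ?ord1 //.
by rewrite (eq_laplacian trelE).
Qed.

Theorem det_laplacian_rank1 e (u v : V -> R) (r : V) : symmetric e ->
  \det (fin_mx (fun x y => laplacian e x y + u x * v y)) =
    (\sum_x u x) * (\sum_y v y) * (num_spanning_trees e)%:R.
Proof.
move=> e_sym.
have [n [f f_bij]] : exists n, exists f : 'I_(1 + n) -> V, bijective f.
  have : exists f : 'I_#|V| -> V, bijective f.
    by exists enum_val; apply: enum_val_bij.
  have /card_gt0P : exists x, x \in V by exists r.
  by case: #|V| => // n _; exists n.
have f_sum (g : V -> R) : \sum_i g (f i) = \sum_x g x.
  by rewrite [RHS](reindex f) //; apply: onW_bij.
pose L : 'M[R]_(1 + n) := \matrix_(i, j) laplacian e (f i) (f j).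
have rowsL : L *m const_mx 1 = 0 :> 'cV_(1 + n).
  apply/colP => i; rewrite !mxE -[RHS](sum_laplacian e (f i)) -f_sum.
  by apply: eq_bigr => j _; rewrite !mxE mulr1.
have colsL : const_mx 1 *m L = 0 :> 'rV_(1 + n).
  apply/rowP => j; rewrite !mxE -[RHS](sum_laplacian e (f j)) -f_sum.
  by apply: eq_bigr => i _; rewrite !mxE mul1r laplacian_sym.
pose U : 'cV[R]_(1 + n) := \col_i u (f i).
pose W : 'rV[R]_(1 + n) := \row_j v (f j).
have -> : \sum_x u x = \sum_i U i 0.
  by rewrite -f_sum; apply: eq_bigr => i _; rewrite mxE.
have -> : \sum_y v y = \sum_j W 0 j.
  by rewrite -f_sum; apply: eq_bigr => j _; rewrite mxE.
rewrite -(matrix_tree e_sym f_bij) (det_fin_mx _ f_bij) -det_add_rank1 //.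
by congr (\det _); apply/matrixP => i j; rewrite !mxE big_ord1 !mxE.
Qed.

End MatrixTree.

(** * Incidence matrices *)

Lemma sum_natr_pred (R : pzSemiRingType) (I : finType) (P : pred I) :
  \sum_i (P i)%:R = #|[set i | P i]|%:R :> R.
Proof. by rewrite -natr_sum card_set_sum. Qed.

Section Incidence.

Variables (V : finType) (e : rel V).

Lemma card_edge_t : #|{: edge_t e}| = #|edge_set e|.
Proof. by rewrite card_sig; apply: eq_card => A; rewrite !inE. Qed.

Lemma edge_tP (A : edge_t e) : exists x y, e x y /\ val A = [set x; y].
Proof.
by case: A => A /= /existsP[x /existsP[y /andP[exy /eqP AE]]]; exists x, y.
Qed.

Lemma card_edge (A : edge_t e) : irreflexive e -> #|val A| = 2.
Proof.
move=> e_irr; have [x [y [exy ->]]] := edge_tP A; rewrite cards2.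
by have [xy|//] := eqVneq x y; rewrite xy e_irr in exy.
Qed.

Hypothesis e_sym : symmetric e.

Definition edge_of x y (exy : e x y) : edge_t e :=
  exist (fun A => is_edge e A) [set x; y] (etrans (is_edge_set2 x y e_sym) exy).

Lemma card_incident_edges x : #|[set A : edge_t e | x \in val A]| = deg e x.
Proof.
have pair_inj : injective (fun y => [set x; y]).
  move=> y z /eqP; rewrite eq_set2 eqxx /=.
  by case/orP=> [/eqP //|/andP[/eqP <- /eqP]].
rewrite /deg -(card_imset _ val_inj) -[RHS](card_imset _ pair_inj).
apply: eq_card => A; apply/imsetP/imsetP => -[].
  move=> B; rewrite inE => xB ->; have [u [v [euv BE]]] := edge_tP B.
  move: xB; rewrite BE => /set2P[->|->]; first by exists v; rewrite ?inE.
  by exists u; rewrite ?inE 1?e_sym // setUC.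
by move=> y; rewrite inE => exy ->; exists (edge_of exy); rewrite ?inE ?eqxx.
Qed.

Lemma card_joining_edges x y : x != y ->
  #|[set A : edge_t e | (x \in val A) && (y \in val A)]| = e x y.
Proof.
move=> xy.
have edgeE (A : edge_t e) : x \in val A -> y \in val A -> val A = [set x; y].
  have [u [v [_ ->]]] := edge_tP A.
  move=> /set2P[xE|xE] /set2P[yE|yE]; rewrite xE yE ?eqxx // in xy *.
  by rewrite setUC.
have [exy|nexy] := boolP (e x y).
  apply/eqP/cards1P; exists (edge_of exy); apply/setP => A; rewrite !inE.
  apply/andP/eqP => [[xA yA]|->]; last by rewrite !inE !eqxx orbT.
  exact/val_inj/edgeE.
apply/eqP; rewrite cards_eq0 -subset0; apply/subsetP => A; rewrite !inE.
case/andP=> xA yA; case/negP: nexy.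
by rewrite -(is_edge_set2 x y e_sym) -(edgeE A) //; apply: valP.
Qed.

End Incidence.

Section IncidenceMatrix.

Variables (R : comPzRingType) (V : finType) (e : rel V).

Definition incidence_mx : 'M[R]_(#|V|, #|{: edge_t e}|) :=
  fin_mx (fun x (A : edge_t e) => (x \in val A)%:R).

Definition adjacency_mx : 'M[R]_#|V| := fin_mx (fun x y => (e x y)%:R).

Lemma incidence_mx_mul_tr r : simple_graph e -> regular e r ->
  incidence_mx *m incidence_mx^T = r%:R%:M + adjacency_mx.
Proof.
move=> [e_sym e_irr] e_reg.
have -> : incidence_mx^T = fin_mx (fun (A : edge_t e) x => (x \in val A)%:R).
  by apply/matrixP => i j; rewrite !mxE.
rewrite fin_mx_mul -fin_mx_scalar; apply/matrixP => i j; rewrite !mxE.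
move: (enum_val i) (enum_val j) => x y.
under eq_bigr => A _ do rewrite -natrM mulnb.
rewrite sum_natr_pred; have [->|xy] := eqVneq x y.
  rewrite e_irr addr0 mulr1n -(e_reg y) -(card_incident_edges e_sym).
  by congr _%:R; apply: eq_card => A; rewrite !inE andbb.
by rewrite card_joining_edges // mulr0n add0r.
Qed.

End IncidenceMatrix.

(** * Subdivision joins *)

(* [p] and [q] tell whether the original, resp. the subdivision vertices of [S(G1)]
   are joined to [G2]. *)
Definition subdivision_join (V1 V2 : finType) (e1 : rel V1) (e2 : rel V2)
    (p q : bool) : rel ((V1 + edge_t e1) + V2) :=
  fun a b =>
    match a, b with
    | inl (inl x), inl (inr A) => x \in val A
    | inl (inr A), inl (inl x) => x \in val A
    | inr y, inr y' => e2 y y'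
    | inl (inl _), inr _ => p
    | inr _, inl (inl _) => p
    | inl (inr _), inr _ => q
    | inr _, inl (inr _) => q
    | _, _ => false
    end.

Arguments subdivision_join {V1 V2} e1 e2 p q _ _.

Lemma svjoinE n1 n2 (e1 : rel 'I_n1) (e2 : rel 'I_n2) :
  svjoin e1 e2 = subdivision_join e1 e2 true false.
Proof. by []. Qed.

Lemma sejoinE n1 n2 (e1 : rel 'I_n1) (e2 : rel 'I_n2) :
  sejoin e1 e2 = subdivision_join e1 e2 false true.
Proof. by []. Qed.

Definition num_joined (V1 : finType) (e1 : rel V1) (p q : bool) : nat :=
  (p * #|V1| + q * #|edge_set e1|)%N.

(* In the join with an [n]-vertex graph, an original vertex of degree [r] has degree
   [r + p n] and a subdivision vertex has degree [2 + q n]; the product of these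
   degrees exceeds its value [2 r] in [S(G1)] by [n] times this number. *)
Definition degree_product_excess (n r : nat) (p q : bool) : nat :=
  (2 * p + q * (r + p * n))%N.

Lemma degree_productE n r (p q : bool) :
  ((2 + q * n) * (r + p * n) = n * degree_product_excess n r p q + r + r)%N.
Proof. by rewrite /degree_product_excess; case: p q => -[]; ring. Qed.

Section SubdivisionJoin.

Variables (V1 V2 : finType) (e1 : rel V1) (e2 : rel V2) (p q : bool).
Hypotheses (e1_simple : simple_graph e1) (e2_simple : simple_graph e2).

Local Notation J := (subdivision_join e1 e2 p q).
Local Notation joined := (num_joined e1 p q).

Lemma subdivision_join_sym : symmetric J.
Proof. by case=> [[x|A]|y] [[x'|A']|y'] //=; apply: e2_simple.1. Qed.

Lemma deg_subdivision_join a :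
  deg J a = match a with
            | inl (inl x) => deg e1 x + p * #|V2|
            | inl (inr A) => 2 + q * #|V2|
            | inr y => joined + deg e2 y
            end%N.
Proof.
have [e1_sym e1_irr] := e1_simple.
rewrite {1}/deg card_set_sum !big_sumType; case: a => [[x|A]|y] /=.
- rewrite big1 // add0n -(card_incident_edges e1_sym) card_set_sum.
  by rewrite sum_nat_const mulnC.
- rewrite [X in (_ + X + _)%N]big1 // addn0 -card_set_sum cardsE.
  by rewrite (card_edge A e1_irr) sum_nat_const mulnC.
rewrite !sum_nat_const /num_joined -card_edge_t /deg card_set_sum.
by rewrite ![(_ * nat_of_bool _)%N]mulnC.
Qed.

Variables (R : comPzRingType) (r1 r2 : nat).
Hypotheses (e1_reg : regular e1 r1) (e2_reg : regular e2 r2).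

Definition joined_indicator (a : (V1 + edge_t e1) + V2) : R :=
  match a with inl (inl _) => p%:R | inl (inr _) => q%:R | inr _ => 0 end.

Definition right_indicator (a : (V1 + edge_t e1) + V2) : R :=
  if a is inr _ then 1 else 0.

Definition decoupled_laplacian a b : R :=
  laplacian R J a b + joined_indicator a * right_indicator b.

Lemma det_decoupled_laplacian_left :
  (2 + q * #|V2|)%:R ^+ #|V1| *
      \det (fin_mx (fun a b => decoupled_laplacian (inl a) (inl b))) =
    (2 + q * #|V2|)%:R ^+ #|edge_set e1| *
      \det ((#|V2| * degree_product_excess #|V2| r1 p q + r1)%:R%:M
              - adjacency_mx R e1).
Proof.
have decoupledE : fin_mx (fun a b => decoupled_laplacian (inl a) (inl b)) =
    fin_mx (fun a b => laplacian R J (inl a) (inl b)).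
  by apply/matrixP => i j; rewrite !mxE /decoupled_laplacian mulr0 addr0.
set B := incidence_mx R e1.
have -> : (#|V2| * degree_product_excess #|V2| r1 p q + r1)%:R%:M
            - adjacency_mx R e1 =
    (2 + q * #|V2|)%:R *: (r1 + p * #|V2|)%:R%:M - (- B) *m (- B^T).
  rewrite mulNmx mulmxN opprK (incidence_mx_mul_tr R e1_simple e1_reg).
  rewrite opprD addrA scale_scalar_mx -raddfB /= -natrM degree_productE.
  by rewrite [in RHS]natrD addrK.
rewrite -card_edge_t -det_scalar_block decoupledE det_fin_mx_sum.
congr (_ * \det (block_mx _ _ _ _)).
- rewrite -fin_mx_scalar; apply/matrixP => i j.
  by rewrite !mxE /laplacian deg_subdivision_join e1_reg subr0.
- by apply/matrixP => i j; rewrite !mxE /laplacian mulr0n sub0r.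
- by apply/matrixP => i j; rewrite !mxE /laplacian mulr0n sub0r.
rewrite -fin_mx_scalar; apply/matrixP => i j.
by rewrite !mxE /laplacian deg_subdivision_join subr0.
Qed.

Lemma decoupled_laplacian_right :
  fin_mx (fun y y' => decoupled_laplacian (inr y) (inr y')) =
    (joined + r2)%:R%:M - adjacency_mx R e2.
Proof.
rewrite -fin_mx_scalar; apply/matrixP => i j; rewrite !mxE /decoupled_laplacian.
by rewrite mul0r addr0 /laplacian deg_subdivision_join e2_reg.
Qed.

Theorem num_spanning_trees_subdivision_join_det (y : V2) :
  (2 + q * #|V2|)%:R ^+ #|V1| * (joined%:R * #|V2|%:R * (num_spanning_trees J)%:R) =
    (2 + q * #|V2|)%:R ^+ #|edge_set e1| *
      \det ((#|V2| * degree_product_excess #|V2| r1 p q + r1)%:R%:M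
              - adjacency_mx R e1) *
      \det ((joined + r2)%:R%:M - adjacency_mx R e2).
Proof.
have sum_joined : \sum_a joined_indicator a = joined%:R.
  rewrite !big_sumType /= !sumr_const mul0rn addr0 /num_joined natrD !natrM.
  by rewrite !mulr_natr card_edge_t.
have sum_right : \sum_a right_indicator a = #|V2|%:R.
  by rewrite !big_sumType /= !sumr_const !mul0rn !add0r.
rewrite -sum_joined -sum_right.
rewrite -(det_laplacian_rank1 _ _ (inr y) subdivision_join_sym) det_fin_mx_sum.
have -> : fin_mx (fun a y => decoupled_laplacian (inl a) (inr y)) = 0.
  apply/matrixP => i j; rewrite !mxE /decoupled_laplacian /laplacian mulr1.
  by case: (enum_val i) => [x|A]; rewrite mulr0n sub0r addNr.
by rewrite det_lblock mulrA det_decoupled_laplacian_left decoupled_laplacian_right.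
Qed.

End SubdivisionJoin.

(** * Spectra of regular graphs *)

Lemma prodrMl_seq (R : comPzSemiRingType) (I : Type) (s : seq I) (c : R)
    (F : I -> R) :
  \prod_(i <- s) (c * F i) = c ^+ size s * \prod_(i <- s) F i.
Proof. by rewrite big_split /= big_const_seq count_predT iter_mulr_1. Qed.

Lemma horner_char_poly (R : comNzRingType) n (L : 'M[R]_n) (a : R) :
  (char_poly L).[a] = \det (a%:M - L).
Proof.
rewrite -horner_evalE -det_map_mx; congr (\det _); apply/matrixP => i j.
by rewrite !mxE /= horner_evalE hornerD hornerN hornerC hornerMn hornerX.
Qed.

Lemma size_char_poly_roots (R : idomainType) n (L : 'M[R]_n) (s : seq R) :
  char_poly L = \prod_(x <- s) ('X - x%:P) -> n = size s.
Proof.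
by move/(congr1 (size \o val)); rewrite /= size_char_poly size_prod_XsubC => -[].
Qed.

Lemma prod_XsubC_cons0 (R : nzRingType) (s : seq R) :
  \prod_(x <- 0 :: s) ('X - x%:P) = 'X * \prod_(x <- s) ('X - x%:P).
Proof. by rewrite big_cons subr0. Qed.

Lemma size_char_poly_root0 (R : idomainType) n (L : 'M[R]_n) (s : seq R) :
  char_poly L = 'X * \prod_(x <- s) ('X - x%:P) -> n = (size s).+1.
Proof. by rewrite -prod_XsubC_cons0 => /size_char_poly_roots. Qed.

Lemma det_scalar_add_char_poly (R : fieldType) n (L : 'M[R]_n) (s : seq R)
    (c r : R) :
    r != 0 -> char_poly L = \prod_(x <- s) ('X - x%:P) ->
  \det (c%:M + r *: L) = \prod_(x <- s) (c + r * x).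
Proof.
move=> r_neq0 charL.
have -> : c%:M + r *: L = (- r) *: ((- c / r)%:M - L).
  by rewrite scalerBr scale_scalar_mx scaleNr opprK; congr (_%:M + _); field.
rewrite detZ -horner_char_poly charL horner_prod (size_char_poly_roots charL).
rewrite -prodrMl_seq; apply: eq_bigr => x _.
by rewrite hornerXsubC; field.
Qed.

Lemma adj_mx_nlap (R : rcfType) n (e : rel 'I_n) r : regular e r -> (0 < r)%N ->
  adj_mx R e = r%:R%:M - r%:R *: nlap R e.
Proof.
move=> e_reg r_gt0; apply/matrixP => i j.
have r_neq0 : (r%:R : R) != 0 by rewrite pnatr_eq0 -lt0n.
by rewrite !mxE !e_reg -expr2 sqr_sqrtr ?ler0n // -mulr_natr; field.
Qed.

Lemma det_scalar_sub_adjacency_ord (R : rcfType) n (e : rel 'I_n) (c : R) :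
  \det (c%:M - adjacency_mx R e) = \det (c%:M - adj_mx R e).
Proof.
transitivity (\det (fin_mx (fun x y => c *+ (x == y) - (e x y)%:R))).
  by rewrite -fin_mx_scalar; congr (\det _); apply/matrixP => i j; rewrite !mxE.
rewrite (det_fin_mx (f := id)); last by exists id.
by congr (\det _); apply/matrixP => i j; rewrite !mxE.
Qed.

Lemma det_scalar_sub_adjacency_regular (R : rcfType) n (e : rel 'I_n) r
    (mu : seq R) (c : R) :
    regular e r -> (0 < r)%N ->
    char_poly (nlap R e) = 'X * \prod_(x <- mu) ('X - x%:P) ->
  \det ((c + r%:R)%:M - adjacency_mx R e) = c * \prod_(x <- mu) (c + r%:R * x).
Proof.
move=> e_reg r_gt0 char_nlap; rewrite det_scalar_sub_adjacency_ord.
rewrite (adj_mx_nlap R e_reg r_gt0) opprB raddfD /= addrACA subrr addr0.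
rewrite (det_scalar_add_char_poly (s := 0 :: mu)) ?prod_XsubC_cons0 //.
  by rewrite big_cons mulr0 addr0.
by rewrite pnatr_eq0 -lt0n.
Qed.

(** * Spanning trees of subdivision joins *)

Lemma edge_set_gt0 (V : finType) (e : rel V) x :
  (0 < deg e x)%N -> (0 < #|edge_set e|)%N.
Proof.
case/card_gt0P=> y; rewrite inE => exy; apply/card_gt0P; exists [set x; y].
by rewrite inE; apply/existsP; exists x; apply/existsP; exists y; rewrite exy eqxx.
Qed.

Lemma num_joined_gt0 (V : finType) (e : rel V) (p q : bool) x :
  (0 < deg e x)%N -> p || q -> (0 < num_joined e p q)%N.
Proof.
move=> /edge_set_gt0 e_gt0; have V_gt0 : (0 < #|V|)%N by apply/card_gt0P; exists x.
by rewrite addn_gt0 !muln_gt0 e_gt0 V_gt0 !andbT !lt0b.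
Qed.

Theorem num_spanning_trees_subdivision_join (R : rcfType) (n1 n2 r1 r2 : nat)
  (e1 : rel 'I_n1) (e2 : rel 'I_n2) (mu nu : seq R) (p q : bool)
  (d := degree_product_excess n2 r1 p q) :
    simple_graph e1 -> simple_graph e2 -> regular e1 r1 -> regular e2 r2 ->
    (0 < r1)%N -> (0 < r2)%N -> p || q ->
    char_poly (nlap R e1) = 'X * \prod_(x <- mu) ('X - x%:P) ->
    char_poly (nlap R e2) = 'X * \prod_(x <- nu) ('X - x%:P) ->
  (num_spanning_trees (subdivision_join e1 e2 p q))%:R =
    (2 + q * n2)%:R ^ (#|edge_set e1|%:Z - n1%:Z) * d%:R
    * \prod_(x <- mu) ((n2 * d)%:R + r1%:R * x)
    * \prod_(y <- nu) ((num_joined e1 p q)%:R + r2%:R * y).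
Proof.
move=> simple1 simple2 reg1 reg2 r1_gt0 r2_gt0 pq char1 char2.
have n1_gt0 : (0 < n1)%N by rewrite (size_char_poly_root0 char1).
have n2_gt0 : (0 < n2)%N by rewrite (size_char_poly_root0 char2).
have joined_gt0 : (0 < num_joined e1 p q)%N.
  by apply: (num_joined_gt0 (x := Ordinal n1_gt0)); rewrite // reg1.
have := num_spanning_trees_subdivision_join_det p q simple1 simple2 R reg1 reg2
  (Ordinal n2_gt0).
rewrite [(_ + r1)%:R]natrD [(_ + r2)%:R]natrD.
rewrite (det_scalar_sub_adjacency_regular _ reg1 r1_gt0 char1).
rewrite (det_scalar_sub_adjacency_regular _ reg2 r2_gt0 char2) !card_ord -/d.
move: (num_joined e1 p q) joined_gt0 (num_spanning_trees _) => j j_gt0 t.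
set b := (2 + q * n2)%N; set m := #|edge_set e1|.
have natr_neq0 k : (0 < k)%N -> k%:R != 0 :> R by rewrite pnatr_eq0 -lt0n.
have -> : b%:R ^+ m = b%:R ^ (m%:Z - n1%:Z) * b%:R ^+ n1 :> R.
  by rewrite -[_ ^+ n1]/(_ ^ n1%:Z) -expfzDr ?natr_neq0 // subrK.
have coef_neq0 : b%:R ^+ n1 * (j%:R * n2%:R) != 0 :> R.
  by rewrite !mulf_neq0 ?expf_neq0 ?natr_neq0.
move=> det_eq; apply: (mulfI coef_neq0); rewrite -[LHS]mulrA det_eq natrM.
move: (_ ^ _) (_ ^+ _) (\prod_(x <- mu) _) (\prod_(y <- nu) _) => a c P Q.
by ring.
Qed.

Theorem theorem3p4 (R : rcfType) (n1 n2 r1 r2 m1 : nat)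
  (e1 : rel 'I_n1) (e2 : rel 'I_n2)
  (mu nu : seq R) :
  simple_graph e1 -> simple_graph e2 ->
  regular e1 r1 -> regular e2 r2 ->
  (1 <= r1)%N -> (1 <= r2)%N ->
  #|edge_set e1| = m1 ->
  (* normalized Laplacian eigenvalues: 0 = mu_1, mu_2, ..., mu_{n1} where
     mu = [:: mu_2; ...; mu_{n1}] (similarly for nu) *)
  char_poly (nlap R e1) = 'X * \prod_(x <- mu) ('X - x%:P) ->
  char_poly (nlap R e2) = 'X * \prod_(x <- nu) ('X - x%:P) ->
  ((num_spanning_trees (svjoin e1 e2))%:R =
     (2 : R) ^ (m1%:Z - n1%:Z + 1)
     * \prod_(x <- mu) (2 * n2%:R + r1%:R * x)
     * \prod_(y <- nu) (n1%:R + r2%:R * y))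
  /\
  ((num_spanning_trees (sejoin e1 e2))%:R =
     (r1%:R : R) ^+ n1 * (2 + n2%:R : R) ^ (m1%:Z - n1%:Z)
     * \prod_(x <- mu) (n2%:R + x)
     * \prod_(y <- nu) (m1%:R + r2%:R * y)).
Proof.
move=> simple1 simple2 reg1 reg2 r1_gt0 r2_gt0 <- char1 char2.
have count p q := @num_spanning_trees_subdivision_join R n1 n2 r1 r2 e1 e2 mu nu p q
  simple1 simple2 reg1 reg2 r1_gt0 r2_gt0.
rewrite svjoinE sejoinE !count // /num_joined /degree_product_excess !card_ord.
rewrite !(mul0n, mul1n, addn0, add0n, muln0, muln1).
split.
  by rewrite [in RHS]expfzDr ?pnatr_eq0 // expr1z natrM [2 * _]mulrC.
have -> : \prod_(x <- mu) ((n2 * r1)%:R + r1%:R * x) =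
    r1%:R ^+ size mu * \prod_(x <- mu) (n2%:R + x) :> R.
  by rewrite -prodrMl_seq; apply: eq_bigr => x _; rewrite natrM; ring.
rewrite natrD [in _ ^+ n1](size_char_poly_root0 char1) exprS.
move: (_ ^ _) (_ ^+ _) (\prod_(x <- mu) _) (\prod_(y <- nu) _) => a b P Q.
by ring.
Qed.
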